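(* Let $(L,[\cdot_\lambda\cdot],\alpha)$ be a Hom-Leibniz conformal algebra and let $N:L\to L$ be a Nijenhuis operator on it. Then $(L,\triangleleft_\lambda,\triangleright_\lambda,\vee_\lambda,\alpha)$ is a Hom-$NS$-Leibniz conformal algebra, where for $p,q\in L$ $$p\triangleleft_\lambda q=[N(p)_\lambda q],\qquad p\triangleright_\lambda q=[p_\lambda N(q)],\qquad p\vee_\lambda q=-N[p_\lambda q].$$
   Context: All vector spaces are over $\mathbb C$; $V[\lambda]$ denotes polynomials in $\lambda$ with coefficients in $V$, and linear maps are extended coefficientwise to polynomials. A bilinear map $\circ_\lambda:L\otimes L\to L[\lambda]$ on a $\mathbb C[\partial]$-module is conformal sesqui-linear if $(\partial p)\circ_\lambda q=-\lambda\,p\circ_\lambda q$ and $p\circ_\lambda(\partial q)=(\partial+\lambda)(p\circ_\lambda q)$. A Hom-Leibniz conformal algebra $(L,[\cdot_\lambda\cdot],\alpha)$ is a $\mathbb C[\partial]$-module $L$ with a conformal sesqui-linear map $[\cdot_\lambda\cdot]:L\otimes L\to L[\lambda]$ and a linear map $\alpha:L\to L$ such that for all $p,q,r\in L$: $\alpha\partial=\partial\alpha$; $\alpha[p_\lambda q]=[\alpha(p)_\lambda\alpha(q)]$; $[\alpha(p)_\lambda[q_\mu r]]=[[p_\lambda q]_{\lambda+\mu}\alpha(r)]+[\alpha(q)_\mu[p_\lambda r]]$. A Nijenhuis operator on it is a $\mathbb C[\partial]$-linear map $N:L\to L$ with $\alpha N=N\alpha$ and $[N(p)_\lambda N(q)]=N([N(p)_\lambda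 q]+[p_\lambda N(q)]-N[p_\lambda q])$ for all $p,q\in L$. A Hom-$NS$-Leibniz conformal algebra $(L,\triangleleft_\lambda,\triangleright_\lambda,\vee_\lambda,\alpha)$ is a $\mathbb C[\partial]$-module $L$ with conformal sesqui-linear maps $\triangleleft_\lambda,\triangleright_\lambda,\vee_\lambda:L\otimes L\to L[\lambda]$ and a linear map $\alpha:L\to L$ with $\alpha\partial=\partial\alpha$, $\alpha(p\triangleleft_\lambda q)=\alpha(p)\triangleleft_\lambda\alpha(q)$, $\alpha(p\triangleright_\lambda q)=\alpha(p)\triangleright_\lambda\alpha(q)$, $\alpha(p\vee_\lambda q)=\alpha(p)\vee_\lambda\alpha(q)$ such that, writing $p*_\lambda q=p\triangleleft_\lambda q+p\triangleright_\lambda q+p\vee_\lambda q$, for all $p,q,r\in L$: $\alpha(p)\triangleright_\lambda(q*_\mu r)=(p\triangleright_\lambda q)\triangleright_{\lambda+\mu}\alpha(r)+\alpha(q)\triangleleft_\mu(p\triangleright_\lambda r)$; $\alpha(p)\triangleleft_\lambda(q\triangleright_\mu r)=(p\triangleleft_\lambda q)\triangleright_{\lambda+\mu}\alpha(r)+\alpha(q)\triangleright_\mu(p*_\lambda r)$; $\alpha(p)\triangleleft_\lambda(q\triangleleft_\mu r)=(p*_\lambda q)\triangleleft_{\lambda+\mu}\alpha(r)+\alpha(q)\triangleleft_\mu(p\triangleleft_\lambda r)$; $\alpha(p)\vee_\lambda(q*_\mu r)-\alpha(q)\vee_\mu(p*_\lambda r)-(p*_\lambda q)\vee_{\lambda+\mu}\alpha(r)+\alpha(p)\triangleleft_\lambda(q\vee_\mu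 r)-\alpha(q)\triangleleft_\mu(p\vee_\lambda r)-(p\vee_\lambda q)\triangleright_{\lambda+\mu}\alpha(r)=0$. *)

(* Defs.v *)
From HB Require Import structures.
From mathcomp Require Import all_boot all_order all_algebra finmap.
From mathcomp Require Import reals complex monalg.

Set Implicit Arguments.
Unset Strict Implicit.
Unset Printing Implicit Defensive.

Import GRing.Theory.
Local Open Scope ring_scope.

(* The polynomial spaces V[lambda] and V[lambda, mu], as finitely supported
   families of coefficients: the coefficient of lambda^k is [f@_k], that of
   lambda^i mu^j is [f@_(i, j)], and [<< v *g (i, j) >>] is the monomial
   v lambda^i mu^j. *)
Notation poly1 V := {malg V[nat]}.
Notation poly2 V := {malg V[(nat * nat)%type]}.

Section Polynomials.
Variable V : zmodType.

Definition mapcoef (h : V -> V) (f : poly1 V) : poly1 V :=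
  \sum_(k <- msupp f) << h f@_k *g k >>.

Definition mul_lam (f : poly1 V) : poly1 V :=
  \sum_(k <- msupp f) << f@_k *g k.+1 >>.

(* In a polynomial f(nu), the substitutions nu := lambda, nu := mu and
   nu := lambda + mu; the last one by the binomial formula. *)
Definition subst_lam (f : poly1 V) : poly2 V :=
  \sum_(k <- msupp f) << f@_k *g (k, 0%N) >>.

Definition subst_mu (f : poly1 V) : poly2 V :=
  \sum_(k <- msupp f) << f@_k *g (0%N, k) >>.

Definition subst_lammu (f : poly1 V) : poly2 V :=
  \sum_(k <- msupp f) \sum_(0 <= a < k.+1) << f@_k *+ 'C(k, a) *g (k - a, a)%N >>.

(* f lambda^i mu^j *)
Definition mul_mono (i j : nat) (f : poly2 V) : poly2 V :=
  \sum_(k <- msupp f) << f@_k *g (k.1 + i, k.2 + j)%N >>.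

End Polynomials.

Section HomLeibnizConformal.
Variables (K : fieldType) (L : lmodType {poly K}).

(* [op p q] stands for p op_lambda q. *)
Definition lam_product := L -> L -> poly1 L.

Implicit Types (op : lam_product) (p q r : L).

(* A K[d]-module L is a module over {poly K}: d acts as 'X, and K acts through
   the constant polynomials. *)
Definition dact (p : L) : L := 'X *: p.

Definition Klinear (h : L -> L) : Prop :=
  forall (c : K) p q, h (c%:P *: p + q) = c%:P *: h p + h q.

Definition lam_bilinear op : Prop :=
  (forall (c : K) p p' q,
     op (c%:P *: p + p') q = mapcoef ( *:%R c%:P) (op p q) + op p' q) /\
  (forall (c : K) p q q',
     op p (c%:P *: q + q') = mapcoef ( *:%R c%:P) (op p q) + op p q').

Definition conformal_sesquilinear op : Prop :=
  (forall p q, op (dact p) q = - mul_lam (op p q)) /\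
  (forall p q, op p (dact q) = mapcoef dact (op p q) + mul_lam (op p q)).

(* The iterated products in L[lambda, mu], one factor of which is a polynomial:
     prod_lam op p g   is  p op_lambda g(mu),
     prod_mu op q g    is  q op_mu g(lambda),
     prod_lammu op g r is  g(lambda) op_{lambda+mu} r,
   extended coefficientwise in g. *)
Definition prod_lam op p (g : poly1 L) : poly2 L :=
  \sum_(j <- msupp g) mul_mono 0 j (subst_lam (op p g@_j)).

Definition prod_mu op q (g : poly1 L) : poly2 L :=
  \sum_(i <- msupp g) mul_mono i 0 (subst_mu (op q g@_i)).

Definition prod_lammu op (g : poly1 L) r : poly2 L :=
  \sum_(i <- msupp g) mul_mono i 0 (subst_lammu (op g@_i r)).

Record HomLeibnizConformal (br : lam_product) (alpha : L -> L) : Prop := {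
  hlc_bilinear : lam_bilinear br;
  hlc_sesqui : conformal_sesquilinear br;
  hlc_linear : Klinear alpha;
  hlc_dact : forall p, alpha (dact p) = dact (alpha p);
  hlc_mult : forall p q, mapcoef alpha (br p q) = br (alpha p) (alpha q);
  hlc_leibniz : forall p q r,
    prod_lam br (alpha p) (br q r) =
    prod_lammu br (br p q) (alpha r) + prod_mu br (alpha q) (br p r)
}.

Record Nijenhuis (br : lam_product) (alpha : L -> L) (N : {linear L -> L})
    : Prop := {
  nij_comm : forall p, alpha (N p) = N (alpha p);
  nij_eq : forall p q,
    br (N p) (N q) = mapcoef N (br (N p) q + br p (N q) - mapcoef N (br p q))
}.

Definition star (tl tr vee : lam_product) : lam_product :=
  fun p q => tl p q + tr p q + vee p q.

Record HomNSLeibnizConformal (tl tr vee : lam_product) (alpha : L -> L)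
    : Prop := {
  ns_tl_bilinear : lam_bilinear tl;
  ns_tl_sesqui : conformal_sesquilinear tl;
  ns_tr_bilinear : lam_bilinear tr;
  ns_tr_sesqui : conformal_sesquilinear tr;
  ns_vee_bilinear : lam_bilinear vee;
  ns_vee_sesqui : conformal_sesquilinear vee;
  ns_linear : Klinear alpha;
  ns_dact : forall p, alpha (dact p) = dact (alpha p);
  ns_tl_mult : forall p q, mapcoef alpha (tl p q) = tl (alpha p) (alpha q);
  ns_tr_mult : forall p q, mapcoef alpha (tr p q) = tr (alpha p) (alpha q);
  ns_vee_mult : forall p q, mapcoef alpha (vee p q) = vee (alpha p) (alpha q);
  ns_eq1 : forall p q r,
    prod_lam tr (alpha p) (star tl tr vee q r) =
    prod_lammu tr (tr p q) (alpha r) + prod_mu tl (alpha q) (tr p r);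
  ns_eq2 : forall p q r,
    prod_lam tl (alpha p) (tr q r) =
    prod_lammu tr (tl p q) (alpha r)
    + prod_mu tr (alpha q) (star tl tr vee p r);
  ns_eq3 : forall p q r,
    prod_lam tl (alpha p) (tl q r) =
    prod_lammu tl (star tl tr vee p q) (alpha r)
    + prod_mu tl (alpha q) (tl p r);
  ns_eq4 : forall p q r,
    prod_lam vee (alpha p) (star tl tr vee q r)
    - prod_mu vee (alpha q) (star tl tr vee p r)
    - prod_lammu vee (star tl tr vee p q) (alpha r)
    + prod_lam tl (alpha p) (vee q r)
    - prod_mu tl (alpha q) (vee p r)
    - prod_lammu tr (vee p q) (alpha r) = 0
}.

End HomLeibnizConformal.

(* Main.v *)
From HB Require Import structures.
Require Import Defs.
From mathcomp Require Import all_boot all_order all_algebra finmap.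
From mathcomp Require Import reals complex monalg.
Import GRing.Theory.
Local Open Scope ring_scope.

(** Write [p * q] for the sum of the three products; the Nijenhuis identity says
    [N(p * q) = [N p, N q]].  Hence the first three axioms are the Leibniz
    identity of the bracket at the triples [(p, N q, N r)], [(N p, q, N r)] and
    [(N p, N q, r)].  In the fourth axiom, the Nijenhuis identity turns each
    product of two values of [N], such as [[N p, N [q, r]]], into a value of
    [N]; the whole expression is then [- N] of
    J(p, N q, r) + J(p, q, N r) + J(N p, q, r) - N J(p, q, r), where J is the
    left side minus the right side of the Leibniz identity, so it vanishes.

    What this argument leaves implicit is that one may compute with iterated
    products, whose inner factor is a polynomial, as with products of vectors.
    The three iterated products (in lambda, mu and lambda + mu) have the form
    [lift S op g]: apply [op] to each coefficient of [g], then a substitution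
    [S k] depending on the exponent.  The only property of the substitutions
    that matters is that they are natural: additive, and commuting with maps
    applied to the coefficients.  Under this assumption [lift_nijenhuis]
    extends the Nijenhuis identity to polynomial arguments, for the three
    products at once. *)

(** * Sums over the coefficients of a polynomial *)

Section CoefSum.
Context {K : choiceType} {V W : zmodType}.
Implicit Types (F : K -> V -> W) (f g : {malg V[K]}).

Definition coefsum F f : W := \sum_(k <- msupp f) F k f@_k.

Lemma coefsumEw F (d : {fset K}) f :
  (forall k, F k 0 = 0) -> (msupp f `<=` d)%fset ->
  coefsum F f = \sum_(k <- d) F k f@_k.
Proof.
move=> F0 led; rewrite /coefsum (big_fset_incl _ led) // => k _.
by move/mcoeff_outdom->; rewrite F0.
Qed.

Lemma zmod_morphism0 {A B : zmodType} {h : A -> B} :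
  zmod_morphism h -> h 0 = 0.
Proof. by move=> hB; rewrite -[0 in LHS](subrr 0) hB subrr. Qed.

Lemma coefsum_zmod_morphism F :
  (forall k, zmod_morphism (F k)) -> zmod_morphism (coefsum F).
Proof.
move=> FB f g; have F0 k := zmod_morphism0 (FB k).
(* The three supports differ, so the sums are taken over a common superset. *)
rewrite (coefsumEw _ _ _ F0 (msuppB_le f g)).
rewrite (coefsumEw _ _ _ F0 (fsubsetUl (msupp f) (msupp g))).
rewrite (coefsumEw _ _ _ F0 (fsubsetUr (msupp f) (msupp g))) -sumrB.
by apply: eq_bigr => k _; rewrite mcoeffB FB.
Qed.

Lemma coefsumU F k v :
  F k 0 = 0 -> coefsum F << v *g k >> = F k v.
Proof.
move=> F0; rewrite /coefsum msuppU; case: eqP => [->|_].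
  by rewrite big_seq_fset0 F0.
by rewrite big_seq_fset1 mcoeffUU.
Qed.

End CoefSum.

Section MapCoef.
Context {K : choiceType} {V : zmodType}.
Implicit Types (h : {additive V -> V}) (f : {malg V[K]}).

(** For one variable this unfolds to [mapcoef]; the same map is needed on
    polynomials in lambda and mu. *)
Definition coefmap (h : V -> V) : {malg V[K]} -> {malg V[K]} :=
  coefsum (fun k v => << h v *g k >>).

Lemma coefmap_zmod_morphism h : zmod_morphism (coefmap h).
Proof.
by apply: coefsum_zmod_morphism => k u v; rewrite raddfB monalgUB.
Qed.

HB.instance Definition _ h :=
  GRing.isZmodMorphism.Build _ _ (coefmap h) (coefmap_zmod_morphism h).

Lemma coefmapD h : {morph coefmap h : f g / f + g}.
Proof. exact: raddfD. Qed.

Lemma coefmapN h : {morph coefmap h : f / - f}.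
Proof. exact: raddfN. Qed.

Lemma coefmapU h k v : coefmap h << v *g k >> = << h v *g k >>.
Proof. by rewrite /coefmap coefsumU // raddf0 monalgU0. Qed.

Lemma coefsum_coefmap {W : zmodType} (F : K -> V -> W) h f :
  (forall k, zmod_morphism (F k)) ->
  coefsum F (coefmap h f) = coefsum (fun k v => F k (h v)) f.
Proof.
move=> FB.
pose sF : {additive {malg V[K]} -> W} :=
  HB.pack (coefsum F) (GRing.isZmodMorphism.Build _ _ _
    (coefsum_zmod_morphism _ FB)).
transitivity (sF (coefmap h f)) => //.
rewrite /coefmap [X in sF X]/coefsum raddf_sum; apply: eq_bigr => k _.
by rewrite /sF /= coefsumU // zmod_morphism0.
Qed.

End MapCoef.

Lemma coefmap_coefsum {K K' : choiceType} {V : zmodType}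
    (F : K -> V -> {malg V[K']}) (h : {additive V -> V}) f :
  (forall k, zmod_morphism (F k)) ->
  (forall k v, coefmap h (F k v) = F k (h v)) ->
  coefmap h (coefsum F f) = coefsum F (coefmap h f).
Proof.
move=> FB Fh; rewrite coefsum_coefmap // {1}/coefsum raddf_sum.
by apply: eq_bigr => k _; apply: Fh.
Qed.

Lemma coefmap_comp {K : choiceType} {V : zmodType}
    (h h' : {additive V -> V}) (f : {malg V[K]}) :
  coefmap h (coefmap h' f) = coefmap (h \o h') f.
Proof.
by rewrite [LHS]coefsum_coefmap // => k u v; rewrite raddfB monalgUB.
Qed.

Lemma coefmap_id {K : choiceType} {V : zmodType} (h : V -> V)
    (f : {malg V[K]}) :
  h =1 id -> coefmap h f = f.
Proof.
move=> hid; rewrite [RHS]monalgE.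
by apply: eq_bigr => k _; rewrite hid.
Qed.

(** * Natural maps and lifted products *)

Section Natural.
Context {V : zmodType}.

(** Naturality with respect to the coefficients: the map only acts on the
    exponents, up to integer factors. *)
Definition natural {K K' : choiceType} (S : {malg V[K]} -> {malg V[K']}) :=
  zmod_morphism S /\
  forall (h : {additive V -> V}) f, coefmap h (S f) = S (coefmap h f).

Lemma natural_coefsum {K K' : choiceType} (F : K -> V -> {malg V[K']}) :
  (forall k, zmod_morphism (F k)) ->
  (forall (h : {additive V -> V}) k v, coefmap h (F k v) = F k (h v)) ->
  natural (coefsum F).
Proof.
move=> FB Fh; split; first exact: coefsum_zmod_morphism.
by move=> h f; apply: coefmap_coefsum.
Qed.

Lemma natural_comp {K1 K2 K3 : choiceType}
    (S : {malg V[K2]} -> {malg V[K3]}) (T : {malg V[K1]} -> {malg V[K2]}) :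
  natural S -> natural T -> natural (fun f => S (T f)).
Proof.
by move=> [SB Sh] [TB Th]; split=> [f g|h f]; rewrite ?TB ?SB // Sh Th.
Qed.

Lemma natural_reindex {K K' : choiceType} (e : K -> K') :
  natural (coefsum (fun k (v : V) => << v *g e k >>)).
Proof.
by apply: natural_coefsum => [k u v|h k v]; rewrite ?monalgUB ?coefmapU.
Qed.

Lemma natural_mul_lam : natural (@mul_lam V).
Proof. exact: (natural_reindex succn). Qed.

Lemma natural_subst_lam : natural (@subst_lam V).
Proof. exact: (natural_reindex (fun k => (k, 0%N))). Qed.

Lemma natural_subst_mu : natural (@subst_mu V).
Proof. exact: (natural_reindex (fun k => (0%N, k))). Qed.

Lemma natural_mul_mono i j : natural (@mul_mono V i j).
Proof. exact: (natural_reindex (fun k => (k.1 + i, k.2 + j)%N)). Qed.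

Lemma natural_subst_lammu : natural (@subst_lammu V).
Proof.
apply: (natural_coefsum (fun k v =>
  \sum_(0 <= a < k.+1) << v *+ 'C(k, a) *g (k - a, a)%N >>)) => [k u v|h k v].
  by rewrite -sumrB; apply: eq_bigr => a _; rewrite mulrnBl monalgUB.
by rewrite raddf_sum; apply: eq_bigr => a _; rewrite [LHS]coefmapU raddfMn.
Qed.

End Natural.

Section Lift.
Context {V : zmodType} {K K1 K2 : choiceType}.
Variable S : K -> {malg V[K1]} -> {malg V[K2]}.
Hypothesis natS : forall k, natural (S k).
Implicit Types (op : V -> {malg V[K1]}) (g : {malg V[K]}).

(** The common form of [prod_lam], [prod_mu] and [prod_lammu]: [op] is the
    product by the fixed factor, [S k] the substitution for the variable of
    [op] followed by the multiplication by the [k]-th monomial. *)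
Definition lift op : {malg V[K]} -> {malg V[K2]} :=
  coefsum (fun k v => S k (op v)).

Lemma liftB op : zmod_morphism op -> zmod_morphism (lift op).
Proof.
move=> opB; apply: coefsum_zmod_morphism => k u v.
by rewrite opB (natS k).1.
Qed.

Lemma liftD op :
  zmod_morphism op -> {morph lift op : f g / f + g}.
Proof.
move=> /liftB lB f g; rewrite -[g in LHS]opprK lB -[- g]sub0r lB.
by rewrite (zmod_morphism0 lB) sub0r opprK.
Qed.

Lemma lift_coefmap op (h : {additive V -> V}) g :
  zmod_morphism op -> lift op (coefmap h g) = lift (fun v => op (h v)) g.
Proof.
move=> opB; apply: coefsum_coefmap => k u v.
by rewrite opB (natS k).1.
Qed.

Lemma coefmap_lift op (h : {additive V -> V}) g :
  coefmap h (lift op g) = lift (fun v => coefmap h (op v)) g.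
Proof.
by rewrite raddf_sum; apply: eq_bigr => k _; apply: (natS k).2.
Qed.

Lemma lift_sub op op' g :
  lift (fun v => op v - op' v) g = lift op g - lift op' g.
Proof. by rewrite -sumrB; apply: eq_bigr => k _; rewrite (natS k).1. Qed.

Lemma lift_opp op g : lift (fun v => - op v) g = - lift op g.
Proof.
rewrite -sumrN; apply: eq_bigr => k _.
by rewrite -[- op _]sub0r (natS k).1 (zmod_morphism0 (natS k).1) sub0r.
Qed.

Lemma lift_add op op' g :
  lift (fun v => op v + op' v) g = lift op g + lift op' g.
Proof.
rewrite -[lift op' g]opprK -lift_opp -lift_sub; apply: eq_bigr => k _.
by rewrite opprK.
Qed.

(** With [op] the product by [x] and [opN] the product by [N x], the hypothesis
    is the Nijenhuis identity at [x] and [v]. *)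
Lemma lift_nijenhuis op opN (N : {additive V -> V}) g :
  zmod_morphism op -> zmod_morphism opN ->
  (forall v, opN (N v) = coefmap N (opN v + op (N v) - coefmap N (op v))) ->
  lift opN (coefmap N g) =
  coefmap N (lift opN g + lift op (coefmap N g) - coefmap N (lift op g)).
Proof.
move=> opB opNB nij; rewrite !lift_coefmap // coefmap_lift -lift_add -lift_sub.
by rewrite coefmap_lift; apply: eq_bigr => k _; rewrite nij.
Qed.

(** The terms of the fourth axiom that share one iterated product form the left
    side; [g1 + g2 - N g] stands for a value of the sum of the three products.
    The terms in [op (N g)] cancel. *)
Lemma lift_vee_star op opN (N : {additive V -> V}) g1 g2 g :
  zmod_morphism op -> zmod_morphism opN ->
  (forall v, opN (N v) = coefmap N (opN v + op (N v) - coefmap N (op v))) ->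
  lift (fun v => - coefmap N (op v)) (g1 + g2 - coefmap N g)
  + lift opN (- coefmap N g) =
  - coefmap N (lift op g1 + lift op g2 + lift opN g - coefmap N (lift op g)).
Proof.
move=> opB opNB nij; rewrite lift_opp -coefmap_lift liftB // liftD //.
rewrite -[X in lift opN X]sub0r liftB // (zmod_morphism0 (liftB _ opNB)) sub0r.
rewrite (lift_nijenhuis op opN) // -opprD -coefmapD; congr (- coefmap N _).
by rewrite [_ + lift op (coefmap N g)]addrC -!addrA addKr.
Qed.

End Lift.

(** * Regrouping of the terms of the fourth axiom *)

Section Regroup.
Context {A : zmodType}.

(** The [b]'s stand for the terms in mu and the [c]'s for those in lambda + mu;
    each sum [c + b] on the left is one instance of the Leibniz
    identity. *)
Lemma regroup_leibniz (b1 b2 b3 b4 c1 c2 c3 c4 : A) :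
  c2 + b3 + (c3 + b2) + (c1 + b1) - (c4 + b4) =
  b1 + b2 + b3 - b4 + (c1 + c2 + c3 - c4).
Proof. by rewrite opprD !addrA (ACl (6*4*2*8*5*1*3*7)). Qed.

Lemma regroup_axiom4 (t1 t2 t3 t4 t5 t6 x y : A) :
  t1 + t4 = - (x + y) -> t2 + t5 = - x -> t3 + t6 = - y ->
  t1 - t2 - t3 + t4 - t5 - t6 = 0.
Proof.
move=> h14 h25 h36.
rewrite (ACl ((1*4)*((2*5)*(3*6)))) /= -!opprD h14 h25 h36.
by rewrite -opprD subrr.
Qed.

End Regroup.

(** * The products attached to a Nijenhuis operator *)

Section Nijenhuis.
Context {K : fieldType} {L : lmodType {poly K}}.
Implicit Types (op : lam_product L) (p q r : L).

Lemma mapcoefE (h : L -> L) (f : poly1 L) : mapcoef h f = coefmap h f.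
Proof. by []. Qed.

Lemma Klinear_zmod_morphism (h : L -> L) : Klinear h -> zmod_morphism h.
Proof.
move=> hK u v; have := hK (-1) v u.
by rewrite polyCN !scaleN1r addrC => ->; rewrite addrC.
Qed.

Lemma mapcoef1 (f : poly1 L) : mapcoef ( *:%R (1%:P : {poly K})) f = f.
Proof. by apply: coefmap_id => v; rewrite scale1r. Qed.

Lemma lam_bilinearBl op q : lam_bilinear op -> zmod_morphism (op^~ q).
Proof.
move=> [opl _] u v; have := opl 1 v (u - v) q.
by rewrite mapcoef1 polyC1 scale1r subrKC => ->; rewrite addrAC subrr add0r.
Qed.

Lemma lam_bilinearBr op p : lam_bilinear op -> zmod_morphism (op p).
Proof.
move=> [_ opr] u v; have := opr 1 p v (u - v).
by rewrite mapcoef1 polyC1 scale1r subrKC => ->; rewrite addrAC subrr add0r.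
Qed.

Lemma natural_lam j : natural (fun f : poly1 L => mul_mono 0 j (subst_lam f)).
Proof. exact/natural_comp/natural_subst_lam/natural_mul_mono. Qed.

Lemma natural_mu i : natural (fun f : poly1 L => mul_mono i 0 (subst_mu f)).
Proof. exact/natural_comp/natural_subst_mu/natural_mul_mono. Qed.

Lemma natural_lammu i :
  natural (fun f : poly1 L => mul_mono i 0 (subst_lammu f)).
Proof. exact/natural_comp/natural_subst_lammu/natural_mul_mono. Qed.

Section Products.
Variables (br : lam_product L) (alpha : L -> L) (N : {linear L -> L}).
Hypotheses (hl : HomLeibnizConformal br alpha) (hN : Nijenhuis br alpha N).

Let tl : lam_product L := fun p q => br (N p) q.
Let tr : lam_product L := fun p q => br p (N q).
Let vee : lam_product L := fun p q => - mapcoef N (br p q).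

Let brBl q : zmod_morphism (br^~ q).
Proof. exact: lam_bilinearBl (hlc_bilinear hl). Qed.

Let brBr p : zmod_morphism (br p).
Proof. exact: lam_bilinearBr (hlc_bilinear hl). Qed.

Lemma coefmap_star p q : coefmap N (star tl tr vee p q) = br (N p) (N q).
Proof. by rewrite (nij_eq hN). Qed.

Lemma tl_bilinear : lam_bilinear tl.
Proof.
have [brl brr] := hlc_bilinear hl.
by split=> [c p p' q|c p q q']; rewrite /tl ?linearP ?brl ?brr.
Qed.

Lemma tr_bilinear : lam_bilinear tr.
Proof.
have [brl brr] := hlc_bilinear hl.
by split=> [c p p' q|c p q q']; rewrite /tr ?linearP ?brl ?brr.
Qed.

Lemma coefmap_scale (a : {poly K}) (f : poly1 L) :
  coefmap N (coefmap ( *:%R a) f) = coefmap ( *:%R a) (coefmap N f).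
Proof.
by rewrite !coefmap_comp; apply: eq_bigr => k _ /=; rewrite linearZ.
Qed.

Lemma vee_bilinear : lam_bilinear vee.
Proof.
have [brl brr] := hlc_bilinear hl.
by split=> [c p p' q|c p q q'];
  rewrite /vee ?brl ?brr !mapcoefE coefmapD opprD coefmap_scale coefmapN.
Qed.

Lemma tl_sesqui : conformal_sesquilinear tl.
Proof.
have [brl brr] := hlc_sesqui hl.
by split=> p q; rewrite /tl ?brr // /dact linearZ brl.
Qed.

Lemma tr_sesqui : conformal_sesquilinear tr.
Proof.
have [brl brr] := hlc_sesqui hl.
by split=> p q; rewrite /tr ?brl // /dact linearZ brr.
Qed.

Lemma mul_lamN (f : poly1 L) : mul_lam (- f) = - mul_lam f.
Proof.
have [mB _] := @natural_mul_lam L.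
by rewrite -sub0r mB (zmod_morphism0 mB) sub0r.
Qed.

Lemma vee_sesqui : conformal_sesquilinear vee.
Proof.
have [brl brr] := hlc_sesqui hl; have [_ mN] := @natural_mul_lam L.
split=> p q; rewrite /vee ?brl ?brr mul_lamN !mapcoefE.
  by rewrite coefmapN mN.
(* As a scaling by 'X, the action of d on coefficients commutes with [N]. *)
rewrite -[@dact K L]/( *:%R 'X).
by rewrite coefmapD mN opprD coefmap_scale coefmapN.
Qed.

Lemma vee_mult p q : mapcoef alpha (vee p q) = vee (alpha p) (alpha q).
Proof.
pose a : {additive L -> L} := HB.pack alpha (GRing.isZmodMorphism.Build _ _ _
  (Klinear_zmod_morphism _ (hlc_linear hl))).
rewrite /vee -(hlc_mult hl) !mapcoefE (coefmapN a).
rewrite (coefmap_comp a) (coefmap_comp N a).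
by congr (- _); apply: eq_bigr => k _; rewrite /= (nij_comm hN).
Qed.

Lemma prod_lam_tr p g : prod_lam tr p g = prod_lam br p (coefmap N g).
Proof. exact/esym/(lift_coefmap _ natural_lam). Qed.

Lemma prod_mu_tr p g : prod_mu tr p g = prod_mu br p (coefmap N g).
Proof. exact/esym/(lift_coefmap _ natural_mu). Qed.

Lemma prod_lammu_tl g r : prod_lammu tl g r = prod_lammu br (coefmap N g) r.
Proof. exact: esym (lift_coefmap _ natural_lammu (br^~ r) N g (brBl r)). Qed.

Lemma ns_axiom1 p q r :
  prod_lam tr (alpha p) (star tl tr vee q r) =
  prod_lammu tr (tr p q) (alpha r) + prod_mu tl (alpha q) (tr p r).
Proof.
rewrite prod_lam_tr coefmap_star (hlc_leibniz hl) !(nij_comm hN).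
exact: erefl.
Qed.

Lemma ns_axiom2 p q r :
  prod_lam tl (alpha p) (tr q r) =
  prod_lammu tr (tl p q) (alpha r)
  + prod_mu tr (alpha q) (star tl tr vee p r).
Proof.
rewrite prod_mu_tr coefmap_star.
have := hlc_leibniz hl (N p) q (N r); rewrite !(nij_comm hN).
exact: id.
Qed.

Lemma ns_axiom3 p q r :
  prod_lam tl (alpha p) (tl q r) =
  prod_lammu tl (star tl tr vee p q) (alpha r)
  + prod_mu tl (alpha q) (tl p r).
Proof.
rewrite prod_lammu_tl coefmap_star.
have := hlc_leibniz hl (N p) (N q) r; rewrite !(nij_comm hN).
exact: id.
Qed.

(** The Leibniz identities at [(p, N q, r)], [(p, q, N r)], [(N p, q, r)] and
    [(p, q, r)] split the terms in lambda into terms in mu and lambda + mu. *)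
Lemma leibniz_sum p q r :
  prod_lam br (alpha p) (tl q r) + prod_lam br (alpha p) (tr q r)
  + prod_lam tl (alpha p) (br q r)
  - coefmap N (prod_lam br (alpha p) (br q r)) =
  (prod_mu br (alpha q) (tl p r) + prod_mu br (alpha q) (tr p r)
   + prod_mu tl (alpha q) (br p r)
   - coefmap N (prod_mu br (alpha q) (br p r)))
  + (prod_lammu br (tl p q) (alpha r) + prod_lammu br (tr p q) (alpha r)
   + prod_lammu tr (br p q) (alpha r)
   - coefmap N (prod_lammu br (br p q) (alpha r))).
Proof.
have leib := hlc_leibniz hl; have aN := nij_comm hN.
have tlE u (f : poly1 L) : prod_lam tl u f = prod_lam br (N u) f by [].
have tlmuE u (f : poly1 L) : prod_mu tl u f = prod_mu br (N u) f by [].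
have trE u (f : poly1 L) : prod_lammu tr f u = prod_lammu br f (N u) by [].
rewrite tlE tlmuE trE -!aN /tl /tr !leib coefmapD.
exact: regroup_leibniz.
Qed.

Lemma ns_axiom4 p q r :
  prod_lam vee (alpha p) (star tl tr vee q r)
  - prod_mu vee (alpha q) (star tl tr vee p r)
  - prod_lammu vee (star tl tr vee p q) (alpha r)
  + prod_lam tl (alpha p) (vee q r)
  - prod_mu tl (alpha q) (vee p r)
  - prod_lammu tr (vee p q) (alpha r) = 0.
Proof.
(* Two orders of the sum: the polynomial is the right factor of the bracket in
   the first two iterated products and the left factor in the third. *)
have nijr u v : br (N u) (N v) =
    coefmap N (br (N u) v + br u (N v) - coefmap N (br u v)).
  exact: nij_eq hN u v.
have nijl v u : br (N u) (N v) =
    coefmap N (br u (N v) + br (N u) v - coefmap N (br u v)).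
  by rewrite nijr [br (N u) v + _]addrC.
apply: (regroup_axiom4 _ _ _ _ _ _ _ _ _
  (lift_vee_star _ natural_mu (br (alpha q)) (br (N (alpha q))) N
    (tl p r) (tr p r) (br p r) (brBr _) (brBr _) (nijr _))
  (lift_vee_star _ natural_lammu (br^~ (alpha r)) (br^~ (N (alpha r))) N
    (tl p q) (tr p q) (br p q) (brBl _) (brBl _) (nijl _))).
rewrite -coefmapD.
apply: (etrans (lift_vee_star _ natural_lam (br (alpha p)) (br (N (alpha p))) N
  (tl q r) (tr q r) (br q r) (brBr _) (brBr _) (nijr _))).
by congr (- coefmap N _); apply: leibniz_sum.
Qed.

End Products.

Lemma hom_ns_leibniz_of_nijenhuis (br : lam_product L) (alpha : L -> L)
    (N : {linear L -> L}) :
  HomLeibnizConformal br alpha -> Nijenhuis br alpha N ->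
  HomNSLeibnizConformal
    (fun p q => br (N p) q) (fun p q => br p (N q))
    (fun p q => - mapcoef N (br p q)) alpha.
Proof.
move=> hl hN; split.
- exact: tl_bilinear hl.
- exact: tl_sesqui hl.
- exact: tr_bilinear hl.
- exact: tr_sesqui hl.
- exact: vee_bilinear hl.
- exact: vee_sesqui hl.
- exact: hlc_linear hl.
- exact: hlc_dact hl.
- by move=> p q; rewrite (hlc_mult hl) (nij_comm hN).
- by move=> p q; rewrite (hlc_mult hl) (nij_comm hN).
- exact: vee_mult hl hN.
- exact: ns_axiom1 hl hN.
- exact: ns_axiom2 hl hN.
- exact: ns_axiom3 hl hN.
- exact: ns_axiom4 hl hN.
Qed.

End Nijenhuis.

(* The ground field is the field R[i] of complex numbers over the reals R. *)
Theorem proposition5p4 (R : realType) (L : lmodType {poly R[i]})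
    (br : lam_product L) (alpha : L -> L) (N : {linear L -> L}) :
  HomLeibnizConformal br alpha ->
  Nijenhuis br alpha N ->
  HomNSLeibnizConformal
    (fun p q : L => br (N p) q)
    (fun p q : L => br p (N q))
    (fun p q : L => - mapcoef N (br p q))
    alpha.
Proof. exact: hom_ns_leibniz_of_nijenhuis. Qed.
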